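(* Let $k$ be a field with $\operatorname{char}k=0$, let $\tilde{A}=k[[x_1,\ldots,x_d]]$ be the algebra of formal power series and $A=k[x_1,\ldots,x_d]$ the polynomial Hopf algebra. Then there is a one-to-one correspondence between the Poisson algebra structures on $\tilde{A}$ and the co-Poisson coalgebra structures on $A$.
   Context: A Poisson algebra structure on an algebra $B$ is a linear map $\{-,-\}:B\otimes B\to B$ such that $(B,\{-,-\})$ is a Lie algebra and $\{ab,c\}=a\{b,c\}+\{a,c\}b$ for all $a,b,c\in B$. $A$ is regarded as a coalgebra with comultiplication $\Delta$ the algebra map with $\Delta(x_i)=x_i\otimes1+1\otimes x_i$ and counit $\varepsilon(x_i)=0$. $t_n:V^{\otimes n}\to V^{\otimes n}$ is $v_1\otimes\cdots\otimes v_n\mapsto v_n\otimes v_1\otimes\cdots\otimes v_{n-1}$. A co-Poisson coalgebra structure on a coalgebra $(C,\Delta,\varepsilon)$ is a linear map $q:C\to C\otimes C$ such that $(1+t_2)q=0$, $(1+t_3+t_3^2)(q\otimes1)q=0$, and $(\Delta\otimes1)q=(1\otimes q)\Delta-t_3^2(q\otimes1)\Delta$. *)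

(* Defs.v *)
From HB Require Import structures.
From mathcomp Require Import all_boot all_order all_algebra.
From mathcomp Require Import boolp.
From mathcomp Require Import generic_quotient ssrcomplements mpoly.

Set Implicit Arguments.
Unset Strict Implicit.
Unset Printing Implicit Defensive.

Import GRing.Theory.
Local Open Scope ring_scope.
Local Open Scope quotient_scope.

Local Notation bilin b := (bilinear_for *:%R *:%R b).

Section Bilin.
Variables (k : comNzRingType) (V W U : lmodType k) (b : V -> W -> U).
Hypothesis hb : bilin b.

Lemma bilDl v v' w : b (v + v') w = b v w + b v' w.
Proof. by have := hb.1 w 1 v v'; rewrite /= !scale1r. Qed.
Lemma bilDr v w w' : b v (w + w') = b v w + b v w'.
Proof. by have := hb.2 v 1 w w'; rewrite /= !scale1r. Qed.
Lemma bil0l w : b 0 w = 0.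
Proof. by apply: (addIr (b 0 w)); rewrite -bilDl !add0r. Qed.
Lemma bil0r v : b v 0 = 0.
Proof. by apply: (addIr (b v 0)); rewrite -bilDr !add0r. Qed.
Lemma bilZl a v w : b (a *: v) w = a *: b v w.
Proof. by have := hb.1 w a v 0; rewrite /= bil0l !addr0. Qed.
Lemma bilZr a v w : b v (a *: w) = a *: b v w.
Proof. by have := hb.2 v a w 0; rewrite /= bil0r !addr0. Qed.
End Bilin.

Section TensorType.
Variables (k : comNzRingType) (V W : lmodType k).

Definition feval (U : lmodType k) (b : V -> W -> U) (s : seq (V * W)) : U :=
  \sum_(p <- s) b p.1 p.2.

(* A sequence of pairs stands for a formal sum of pure tensors (scalars are
   absorbed in the first component).  Two formal sums are identified when no
   bilinear map distinguishes them, which is the congruence generated by the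
   bilinearity relations. *)
Definition feq (s t : seq (V * W)) : bool :=
  `[< forall (U : lmodType k) (b : V -> W -> U), bilin b ->
        feval b s = feval b t >].

Lemma feq_refl : reflexive feq.
Proof. by move=> s; apply/asboolP. Qed.
Lemma feq_sym : ssrbool.symmetric feq.
Proof.
by move=> s t; apply/asboolP/asboolP => h U b hb; rewrite (h U b hb).
Qed.
Lemma feq_trans : transitive feq.
Proof.
move=> s t u /asboolP h1 /asboolP h2; apply/asboolP => U b hb.
by rewrite (h1 U b hb) (h2 U b hb).
Qed.

Canonical feq_equiv := EquivRel feq feq_refl feq_sym feq_trans.

(* A record rather than an alias, to keep unification from unfolding it. *)
Record tensor := Tensor { tclass : {eq_quot feq} }.
HB.instance Definition _ := [isNew for tclass].
HB.instance Definition _ := [Choice of tensor by <:].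

Definition tpi (s : seq (V * W)) : tensor := Tensor (\pi s).
Definition trepr (x : tensor) : seq (V * W) := repr (tclass x).
Lemma treprK : cancel trepr tpi.
Proof. by case=> x; rewrite /tpi /trepr reprK. Qed.
Lemma tpiP (s t : seq (V * W)) : reflect (tpi s = tpi t) (feq s t).
Proof.
apply: (iffP idP) => [st|[/eqP]]; last by rewrite eqmodE.
by congr Tensor; apply/eqP; rewrite eqmodE.
Qed.
Definition tens (v : V) (w : W) : tensor := tpi [:: (v, w)].
End TensorType.

Notation "V ⊗ W" := (tensor V%type W%type)
  (at level 40, left associativity) : type_scope.
Notation "v *t w" := (tens v w)
  (at level 40, left associativity) : ring_scope.

Section TensorModule.
Variables (k : comNzRingType) (V W : lmodType k).
Implicit Types (x y z : V ⊗ W) (s t : seq (V * W)).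

Definition teval (U : lmodType k) (b : V -> W -> U) x : U := feval b (trepr x).

Lemma teval_pi (U : lmodType k) (b : V -> W -> U) s :
  bilin b -> teval b (tpi s) = feval b s.
Proof.
move=> hb; rewrite /teval.
by have /tpiP/asboolP := treprK (tpi s); apply.
Qed.

Lemma teval_inj x y :
  (forall (U : lmodType k) (b : V -> W -> U), bilin b ->
     teval b x = teval b y) -> x = y.
Proof.
move=> h; rewrite -[x]treprK -[y]treprK.
by apply/tpiP/asboolP.
Qed.

Definition tzero : V ⊗ W := tpi [::].
Definition tadd x y : V ⊗ W := tpi (trepr x ++ trepr y).
Definition tscale (c : k) x : V ⊗ W :=
  tpi [seq (c *: p.1, p.2) | p <- trepr x].
Definition topp x : V ⊗ W := tscale (-1) x.

Section Eval.
Variables (U : lmodType k) (b : V -> W -> U).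
Hypothesis hb : bilin b.
Lemma teval0 : teval b tzero = 0.
Proof. by rewrite teval_pi // /feval big_nil. Qed.
Lemma tevalD x y : teval b (tadd x y) = teval b x + teval b y.
Proof. by rewrite teval_pi // /feval big_cat. Qed.
Lemma tevalZ c x : teval b (tscale c x) = c *: teval b x.
Proof.
rewrite teval_pi // /feval big_map scaler_sumr.
by apply: eq_bigr => p _; rewrite (bilZl hb).
Qed.
Lemma tevalN x : teval b (topp x) = - teval b x.
Proof. by rewrite tevalZ scaleN1r. Qed.
Lemma teval_tens v w : teval b (v *t w) = b v w.
Proof. by rewrite teval_pi // /feval big_seq1. Qed.
End Eval.

Lemma taddA : associative tadd.
Proof. by move=> x y z; apply: teval_inj => U b hb; rewrite !tevalD // addrA. Qed.
Lemma taddC : commutative tadd.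
Proof. by move=> x y; apply: teval_inj => U b hb; rewrite !tevalD // addrC. Qed.
Lemma tadd0 : left_id tzero tadd.
Proof.
by move=> x; apply: teval_inj => U b hb; rewrite tevalD // teval0 // add0r.
Qed.
Lemma taddN : left_inverse tzero topp tadd.
Proof.
move=> x; apply: teval_inj => U b hb.
by rewrite tevalD // tevalN // teval0 // addNr.
Qed.
HB.instance Definition _ :=
  GRing.isZmodule.Build (V ⊗ W) taddA taddC tadd0 taddN.

Lemma tscaleA c c' x : tscale c (tscale c' x) = tscale (c * c') x.
Proof. by apply: teval_inj => U b hb; rewrite !tevalZ // scalerA. Qed.
Lemma tscale1 : left_id 1 tscale.
Proof. by move=> x; apply: teval_inj => U b hb; rewrite tevalZ // scale1r. Qed.
Lemma tscaleDr : right_distributive tscale +%R.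
Proof.
move=> c x y; apply: teval_inj => U b hb.
by rewrite tevalZ // !tevalD // !tevalZ // scalerDr.
Qed.
Lemma tscaleDl x : {morph tscale^~ x : a b / a + b}.
Proof.
move=> c c'; apply: teval_inj => U b hb.
by rewrite tevalD // !tevalZ // scalerDl.
Qed.
HB.instance Definition _ :=
  GRing.Zmodule_isLmodule.Build k (V ⊗ W) tscaleA tscale1 tscaleDr tscaleDl.

Lemma tens_bilin : bilin (@tens k V W).
Proof.
split=> [w a v v'|v a w w']; apply: teval_inj => U b hb.
  by rewrite tevalD // tevalZ // !teval_tens // bilDl // bilZl.
by rewrite tevalD // tevalZ // !teval_tens // bilDr // bilZr.
Qed.

Lemma tensDl v v' w : (v + v') *t w = v *t w + v' *t w :> V ⊗ W.
Proof. exact: bilDl tens_bilin _ _ _. Qed.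
Lemma tensDr v w w' : v *t (w + w') = v *t w + v *t w' :> V ⊗ W.
Proof. exact: bilDr tens_bilin _ _ _. Qed.
Lemma tensZl a v w : (a *: v) *t w = a *: (v *t w) :> V ⊗ W.
Proof. exact: bilZl tens_bilin _ _ _. Qed.
Lemma tensZr a v w : v *t (a *: w) = a *: (v *t w) :> V ⊗ W.
Proof. exact: bilZr tens_bilin _ _ _. Qed.

Lemma tens0l w : 0 *t w = 0 :> V ⊗ W.
Proof. exact: bil0l tens_bilin _. Qed.
Lemma tens0r v : v *t 0 = 0 :> V ⊗ W.
Proof. exact: bil0r tens_bilin _. Qed.

Lemma tpi_sum s : tpi s = \sum_(p <- s) p.1 *t p.2.
Proof.
apply: teval_inj => U b hb; rewrite teval_pi // /feval.
elim: s => [|p s ih]; first by rewrite !big_nil; exact/esym/teval0.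
rewrite !big_cons ih; apply/esym.
by rewrite [LHS]tevalD // teval_tens.
Qed.

Lemma tensor_ind (P : V ⊗ W -> Prop) :
  P 0 -> (forall v w x, P x -> P (v *t w + x)) -> forall x, P x.
Proof.
move=> P0 PD x; rewrite -[x]treprK tpi_sum.
by elim: (trepr x) => [|p s ih]; rewrite ?big_nil ?big_cons //; exact: PD.
Qed.

Section Lift.
Variables (U : lmodType k) (b : V -> W -> U).
Hypothesis hb : bilin b.

Lemma teval_linear : linear (teval b).
Proof. by move=> a x y; rewrite [LHS]tevalD // tevalZ. Qed.

End Lift.

Definition tlift (U : lmodType k) (b : V -> W -> U) (hb : bilin b) :
  V ⊗ W -> U := teval b.
HB.instance Definition _ (U : lmodType k) (b : V -> W -> U) (hb : bilin b) :=
  GRing.isLinear.Build k (V ⊗ W) U *:%R (tlift hb) (teval_linear hb).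

Lemma tliftE (U : lmodType k) (b : V -> W -> U) (hb : bilin b) v w : tlift hb (v *t w) = b v w.
Proof. exact: teval_tens. Qed.

Lemma tlinear_ext (U : lmodType k) (f g : {linear V ⊗ W -> U}) :
  (forall v w, f (v *t w) = g (v *t w)) -> f =1 g.
Proof.
move=> h; elim/tensor_ind => [|v w x ih]; first by rewrite !linear0.
by rewrite !linearD h ih.
Qed.
End TensorModule.
Arguments tlift : simpl never.

Section TensorMaps.
Variable k : comNzRingType.

Lemma tmap_bilin (V V' W W' : lmodType k) (f : {linear V -> V'})
  (g : {linear W -> W'}) : bilin (fun v w => f v *t g w).
Proof.
by split=> [w a v v'|v a w w'];
  rewrite linearP ?tensDl ?tensDr ?tensZl ?tensZr.
Qed.

Definition tmap (V V' W W' : lmodType k) (f : {linear V -> V'})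
    (g : {linear W -> W'}) : V ⊗ W -> V' ⊗ W' :=
  tlift (tmap_bilin f g).
HB.instance Definition _ (V V' W W' : lmodType k) (f : {linear V -> V'})
  (g : {linear W -> W'}) := GRing.Linear.on (tmap f g).
Arguments tmap : simpl never.

Lemma tmapE (V V' W W' : lmodType k) (f : {linear V -> V'})
  (g : {linear W -> W'}) v w : tmap f g (v *t w) = f v *t g w.
Proof. exact: tliftE. Qed.

Lemma tswap_bilin (V W : lmodType k) : bilin (fun (v : V) (w : W) => w *t v).
Proof.
by split=> [w a v v'|v a w w']; rewrite ?tensDl ?tensDr ?tensZl ?tensZr.
Qed.

Definition tswap (V W : lmodType k) : V ⊗ W -> W ⊗ V :=
  tlift (tswap_bilin V W).
HB.instance Definition _ (V W : lmodType k) := GRing.Linear.on (@tswap V W).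
Arguments tswap : simpl never.

Lemma tswapE (V W : lmodType k) (v : V) (w : W) : tswap (v *t w) = w *t v.
Proof. exact: tliftE. Qed.

Section Assoc.
Variables U V W : lmodType k.

Lemma tassocV_bilin1 (u : U) : bilin (fun (v : V) (w : W) => u *t v *t w).
Proof.
by split=> [w a v v'|v a w w'];
  rewrite ?(tensDl, tensDr) ?(tensZl, tensZr) ?(tensDl, tensDr) ?(tensZl, tensZr).
Qed.

Lemma tassocV_bilin : bilin (fun (u : U) x => tlift (tassocV_bilin1 u) x).
Proof.
split=> [x a u u'|u a x x']; last by rewrite linearP.
elim/tensor_ind: x => [|v w x ih] /=; first by rewrite !linear0 ?scaler0 addr0.
rewrite !linearD /= ih !tliftE tensDl tensZl tensDl tensZl.
by rewrite addrACA.
Qed.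

Definition tassocV : U ⊗ (V ⊗ W) -> U ⊗ V ⊗ W := tlift tassocV_bilin.
HB.instance Definition _ := GRing.Linear.on tassocV.
Arguments tassocV : simpl never.

Lemma tassocVE u v w : tassocV (u *t (v *t w)) = u *t v *t w.
Proof. by rewrite /tassocV !tliftE. Qed.
End Assoc.

Definition t2 (V : lmodType k) : V ⊗ V -> V ⊗ V := @tswap V V.
HB.instance Definition _ (V : lmodType k) := GRing.Linear.on (@t2 V).
Arguments t2 : simpl never.

Definition t3 (V : lmodType k) : V ⊗ V ⊗ V -> V ⊗ V ⊗ V :=
  @tassocV V V V \o @tswap (V ⊗ V) V.
HB.instance Definition _ (V : lmodType k) := GRing.Linear.on (@t3 V).
Arguments t3 : simpl never.

Lemma t2E (V : lmodType k) (v1 v2 : V) : t2 (v1 *t v2) = v2 *t v1.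
Proof. exact: tswapE. Qed.

Lemma t3E (V : lmodType k) (v1 v2 v3 : V) :
  t3 (v1 *t v2 *t v3) = v3 *t v1 *t v2.
Proof. by rewrite /t3 /= tswapE tassocVE. Qed.

Lemma tfun_bilin (V W : lmodType k) (f : {linear V -> k^o})
  (g : {linear W -> k^o}) : bilin (fun v w => f v * g w : k^o).
Proof.
split=> [w a v v'|v a w w'] /=; rewrite linearP ?mulrDl ?mulrDr.
  by congr (_ + _); exact/esym/mulrA.
by congr (_ + _); exact: mulrCA.
Qed.

(* f ⊗ g followed by the identification k ⊗ k = k *)
Definition tfun (V W : lmodType k) (f : {linear V -> k^o})
    (g : {linear W -> k^o}) : V ⊗ W -> k^o :=
  tlift (tfun_bilin f g).
HB.instance Definition _ (V W : lmodType k) (f : {linear V -> k^o})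
  (g : {linear W -> k^o}) := GRing.Linear.on (tfun f g).
Arguments tfun : simpl never.

Lemma tfunE (V W : lmodType k) (f : {linear V -> k^o})
  (g : {linear W -> k^o}) v w : tfun f g (v *t w) = f v * g w.
Proof. exact: tliftE. Qed.
End TensorMaps.

Section TensorAlgebra.
Variables (k : comNzRingType) (A B : algType k).

Lemma tmul_bilin (y : A ⊗ B) :
  bilin (fun a b => tmap (a \*o (idfun : A -> A)) (b \*o (idfun : B -> B)) y).
Proof.
split=> [b c a a'|a c b b'];
  elim/tensor_ind: y => [|u v y ih] /=; rewrite ?linear0 /= ?scaler0 ?addr0 //.
- rewrite !linearD /= ih !tmapE /= mulrDl -scalerAl tensDl tensZl.
  by rewrite addrACA.
- rewrite !linearD /= ih !tmapE /= mulrDl -scalerAl tensDr tensZr.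
  by rewrite addrACA.
Qed.

Definition tmul (x y : A ⊗ B) : A ⊗ B := tlift (tmul_bilin y) x.

Lemma tmulE a b c d : tmul (a *t b) (c *t d) = (a * c) *t (b * d).
Proof. by rewrite [LHS]tliftE tmapE. Qed.
Lemma tmulDl : left_distributive tmul +%R.
Proof. by move=> x y z; exact: linearD. Qed.
Lemma tmul_tens a b y : 
  tmul (a *t b) y = tmap (a \*o (idfun : A -> A)) (b \*o (idfun : B -> B)) y.
Proof. exact: tliftE. Qed.
Lemma tmul0l y : tmul 0 y = 0. Proof. exact: linear0. Qed.
Lemma tmul0r x : tmul x 0 = 0.
Proof.
elim/tensor_ind: x => [|a b x ih]; first exact: tmul0l.
by rewrite tmulDl ih tmul_tens linear0 addr0.
Qed.
Lemma tmulDr : right_distributive tmul +%R.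
Proof.
elim/tensor_ind => [|a b x ih] y z; first by rewrite !tmul0l addr0.
by rewrite !tmulDl ih !tmul_tens linearD addrACA.
Qed.
Lemma tscalel c x y : c *: tmul x y = tmul (c *: x) y.
Proof. by rewrite /tmul linearZ. Qed.
Lemma tmulA : associative tmul.
Proof.
elim/tensor_ind => [|a b x ihx] y z; first by rewrite !tmul0l.
rewrite !tmulDl ihx; congr (_ + _).
elim/tensor_ind: y => [|a' b' y ihy]; first by rewrite !(tmul0l, tmul0r).
rewrite tmulDl !tmulDr ihy tmulDl; congr (_ + _).
elim/tensor_ind: z {ihy} => [|a'' b'' z ihz]; first by rewrite !tmul0r.
by rewrite !tmulDr ihz !tmulE !mulrA.
Qed.
Lemma tmul1l : left_id (1 *t 1) tmul.
Proof.
elim/tensor_ind => [|a b x ihx]; first by rewrite tmul0r.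
by rewrite tmulDr ihx tmulE !mul1r.
Qed.
Lemma tmul1r : right_id (1 *t 1) tmul.
Proof.
elim/tensor_ind => [|a b x ihx]; first by rewrite tmul0l.
by rewrite tmulDl ihx tmulE !mulr1.
Qed.
HB.instance Definition _ :=
  GRing.Zmodule_isPzRing.Build (A ⊗ B) tmulA tmul1l tmul1r tmulDl tmulDr.

Lemma tensM (a c : A) (b d : B) : (a *t b) * (c *t d) = (a * c) *t (b * d).
Proof. exact: tmulE. Qed.
Lemma tens1 : 1 = 1 *t 1 :> A ⊗ B. Proof. by []. Qed.
Definition tmulr (y x : A ⊗ B) : A ⊗ B := x * y.
Lemma tmulr_linear y : linear (tmulr y).
Proof. by move=> c x x'; rewrite /tmulr mulrDl; congr (_ + _); exact/esym/tscalel. Qed.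
HB.instance Definition _ y :=
  GRing.isLinear.Build k (A ⊗ B) (A ⊗ B) *:%R (tmulr y) (tmulr_linear y).

Lemma tscalerAl (c : k) (x y : A ⊗ B) : c *: (x * y) = (c *: x) * y.
Proof. exact: tscalel. Qed.
Lemma tscalerAr (c : k) (x y : A ⊗ B) : c *: (x * y) = x * (c *: y).
Proof.
elim/tensor_ind: x => [|a b x ih]; first by rewrite !mul0r scaler0.
rewrite !mulrDl scalerDr ih; congr (_ + _).
by rewrite [in LHS]/GRing.mul [in RHS]/GRing.mul /= !tmul_tens linearZ.
Qed.
End TensorAlgebra.

Section TensorComAlgebra.
Variables (k : comNzRingType) (A B : comAlgType k).
Lemma tmulC : commutative (@GRing.mul (A ⊗ B)).
Proof.
elim/tensor_ind => [|a b x ihx] y; first by rewrite mul0r mulr0.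
rewrite mulrDl mulrDr ihx; congr (_ + _).
elim/tensor_ind: y => [|c d y ihy]; first by rewrite mul0r mulr0.
by rewrite mulrDl mulrDr ihy !tensM (mulrC a) (mulrC b).
Qed.
HB.instance Definition _ :=
  GRing.PzRing_hasCommutativeMul.Build (A ⊗ B) tmulC.
End TensorComAlgebra.

Section Structures.
Variable k : comNzRingType.

(* Triple tensor powers are bracketed to the left; tassocV is the canonical
   identification C ⊗ (C ⊗ C) = C ⊗ C ⊗ C. *)
Record coalgebra (C : lmodType k) := Coalgebra {
  comul : {linear C -> C ⊗ C};
  counit : {linear C -> k^o};
  coalg_assoc : forall c,
    tmap comul idfun (comul c) = tassocV (tmap idfun comul (comul c));
  coalg_counitl : forall c,
    tmap counit idfun (comul c) = (1 : k^o) *t c :> k^o ⊗ C;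
  coalg_counitr : forall c,
    tmap idfun counit (comul c) = c *t (1 : k^o) :> C ⊗ k^o
}.

Record copoisson_structure (C : lmodType k) (H : coalgebra C) :=
  CoPoisson {
  cobracket :> {linear C -> C ⊗ C};
  cobracket_anti : forall c, cobracket c + t2 (cobracket c) = 0;
  cobracket_jacobi : forall c,
    let w := tmap cobracket idfun (cobracket c) in
    w + t3 w + t3 (t3 w) = 0;
  cobracket_leibniz : forall c,
    tmap (comul H) idfun (cobracket c) =
      tassocV (tmap idfun cobracket (comul H c))
      - t3 (t3 (tmap cobracket idfun (comul H c)))
}.

Record poisson_structure (B : algType k) := Poisson {
  bracket :> {linear B ⊗ B -> B};
  bracket_alt : forall a, bracket (a *t a) = 0;
  bracket_jacobi : forall a b c,
    bracket (a *t bracket (b *t c)) + bracket (b *t bracket (c *t a))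
      + bracket (c *t bracket (a *t b)) = 0;
  bracket_leibniz : forall a b c,
    bracket ((a * b) *t c) = a * bracket (b *t c) + bracket (a *t c) * b
}.
End Structures.

Section MonomialExtension.
Variables (k : comNzRingType) (d : nat) (U : lmodType k).

(* The linear map {mpoly k[d]} -> U with prescribed values on monomials. *)
Definition mlin (F : 'X_{1..d} -> U) (p : {mpoly k[d]}) : U :=
  \sum_(m <- msupp p) p@_m *: F m.

Lemma mlin_bound F n p : (msize p <= n)%N ->
  mlin F p = \sum_(m : 'X_{1..d < n}) p@_m *: F m.
Proof.
pose I : subFinType _ := 'X_{1..d < n}.
move=> le_pn; rewrite /mlin (big_mksub I) //=; first last.
- by move=> m /msize_mdeg_lt /leq_trans; apply.
- exact: msupp_uniq.
rewrite big_rmcond //= => m.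
by move/memN_msupp_eq0 ->; rewrite scale0r.
Qed.

Lemma mlin_linear F : linear (mlin F).
Proof.
move=> a p q.
pose n := maxn (msize (a *: p + q)) (maxn (msize p) (msize q)).
rewrite !(@mlin_bound F n) ?leq_max ?leqnn ?orbT //.
rewrite scaler_sumr -big_split; apply: eq_bigr => m _ /=.
by rewrite mcoeffD mcoeffZ scalerDl scalerA.
Qed.
HB.instance Definition _ F :=
  GRing.isLinear.Build k {mpoly k[d]} U *:%R (mlin F) (mlin_linear F).

Lemma mlinX F m : mlin F 'X_[m] = F m.
Proof. by rewrite /mlin msuppX big_seq1 mcoeffX eqxx scale1r. Qed.

Lemma mlin_ext (f g : {linear {mpoly k[d]} -> U}) :
  (forall m, f 'X_[m] = g 'X_[m]) -> f =1 g.
Proof.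
move=> h p; rewrite (mpolyE p) !linear_sum; apply: eq_bigr => m _.
by rewrite !linearZ /= h.
Qed.
End MonomialExtension.

Section RightMultiplication.
Variables (k : comNzRingType) (A : algType k) (x : A).
Local Notation delta := (x *t 1 + 1 *t x).
Local Notation mulx := (x \o* (idfun : A -> A)).

Variable D : {linear A -> A ⊗ A}.
Hypothesis DX : forall a, D (a * x) = D a * delta.

Lemma tmapDl_mulr (t : A ⊗ A) :
  tmap D idfun (t * delta) =
  tmap (tmulr delta) idfun (tmap D idfun t) + tmap idfun mulx (tmap D idfun t).
Proof.
elim/tensor_ind: t => [|a b t ih]; first by rewrite mul0r !linear0 addr0.
rewrite mulrDl !linearD /= ih [RHS]addrACA; congr (_ + _).
by rewrite mulrDr !tensM !mulr1 !linearD /= !tmapE /= DX.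
Qed.

Lemma tmapDr_mulr (t : A ⊗ A) :
  tmap idfun D (t * delta) =
  tmap mulx idfun (tmap idfun D t) + tmap idfun (tmulr delta) (tmap idfun D t).
Proof.
elim/tensor_ind: t => [|a b t ih]; first by rewrite mul0r !linear0 addr0.
rewrite mulrDl !linearD /= ih [RHS]addrACA; congr (_ + _).
by rewrite mulrDr !tensM !mulr1 !linearD /= !tmapE /= DX.
Qed.

Lemma tassocV_mulr (t : A ⊗ (A ⊗ A)) :
  tassocV (tmap mulx idfun t) + tassocV (tmap idfun (tmulr delta) t) =
  tmap (tmulr delta) idfun (tassocV t) + tmap idfun mulx (tassocV t).
Proof.
elim/tensor_ind: t => [|a t s ih]; first by rewrite !linear0 !addr0.
rewrite !linearD /= addrACA ih [RHS]addrACA; congr (_ + _) => {ih s}.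
elim/tensor_ind: t => [|b c t ih]; first by rewrite tens0r !linear0 !addr0.
rewrite !tensDr !linearD /= addrACA ih [RHS]addrACA; congr (_ + _) => {ih t}.
rewrite !tmapE /= !tassocVE !tmapE /= /tmulr !mulrDr !tensM !mulr1.
by rewrite tensDr tensDl !linearD /= !tassocVE addrA.
Qed.

Variable e : {linear A -> k^o}.
Hypothesis eX : forall a, e (a * x) = 0.

Lemma tmapel_mulr (t : A ⊗ A) :
  tmap e idfun (t * delta) = tmap idfun mulx (tmap e idfun t).
Proof.
elim/tensor_ind: t => [|a b t ih]; first by rewrite mul0r !linear0.
rewrite mulrDl !linearD /= ih; congr (_ + _).
by rewrite mulrDr !tensM !linearD /= !tmapE /= eX tens0l add0r mulr1.
Qed.

Lemma tmaper_mulr (t : A ⊗ A) :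
  tmap idfun e (t * delta) = tmap mulx idfun (tmap idfun e t).
Proof.
elim/tensor_ind: t => [|a b t ih]; first by rewrite mul0r !linear0.
rewrite mulrDl !linearD /= ih; congr (_ + _).
by rewrite mulrDr !tensM !linearD /= !tmapE /= eX tens0r addr0 mulr1.
Qed.
End RightMultiplication.

Section GeneratedCoalgebra.
Variables (k : comNzRingType) (A : algType k) (I : Type) (X : I -> A).
Hypothesis A_ind : forall P : A -> Prop,
  P 1 -> (forall c a, P a -> P (c *: a)) ->
  (forall a b, P a -> P b -> P (a + b)) -> (forall a i, P a -> P (a * X i)) ->
  forall a, P a.
Variables (D : {linear A -> A ⊗ A}) (e : {linear A -> k^o}).
Hypotheses (D1 : D 1 = 1 *t 1) (e1 : e 1 = 1).
Hypothesis DX : forall a i, D (a * X i) = D a * (X i *t 1 + 1 *t X i).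
Hypothesis eX : forall a i, e (a * X i) = 0.

Lemma gen_assoc a : tmap D idfun (D a) = tassocV (tmap idfun D (D a)).
Proof.
elim/A_ind: a => [|c a ih|a b iha ihb|a i ih].
- by rewrite D1 !tmapE /= D1 tassocVE.
- by rewrite !linearZ /= ih.
- by rewrite !linearD /= iha ihb.
- rewrite DX (tmapDl_mulr (DX^~ i)) ih.
  by rewrite (tmapDr_mulr (DX^~ i)) linearD /= tassocV_mulr.
Qed.

Lemma gen_counitl a : tmap e idfun (D a) = (1 : k^o) *t a.
Proof.
elim/A_ind: a => [|c a ih|a b iha ihb|a i ih].
- by rewrite D1 tmapE /= e1.
- by rewrite !linearZ /= ih tensZr.
- by rewrite !linearD /= iha ihb tensDr.
- by rewrite DX (tmapel_mulr (eX^~ i)) ih tmapE.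
Qed.

Lemma gen_counitr a : tmap idfun e (D a) = a *t (1 : k^o).
Proof.
elim/A_ind: a => [|c a ih|a b iha ihb|a i ih].
- by rewrite D1 tmapE /= e1.
- by rewrite !linearZ /= ih tensZl.
- by rewrite !linearD /= iha ihb tensDl.
- by rewrite DX (tmaper_mulr (eX^~ i)) ih tmapE.
Qed.
Definition gen_coalgebra : coalgebra A :=
  @Coalgebra k A D e gen_assoc gen_counitl gen_counitr.
End GeneratedCoalgebra.

Section PolynomialCoalgebra.
Variables (k : comNzRingType) (d : nat).
Local Notation A := {mpoly k[d]}.

(* The algebra map sending X_i to X_i ⊗ 1 + 1 ⊗ X_i: see mcomul1, mcomulM and
   mcomulX below. *)
Definition mcomul : A -> A ⊗ A :=
  mlin (fun m => \prod_(i < d) ('X_i *t 1 + 1 *t 'X_i) ^+ m i).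
HB.instance Definition _ := GRing.Linear.on mcomul.

Definition mcounit (p : A) : k^o := p.@[fun=> 0].

Lemma mcounit_linear : linear mcounit.
Proof. by move=> a p q; rewrite /mcounit mevalD mevalZ. Qed.
HB.instance Definition _ :=
  GRing.isLinear.Build k A k^o *:%R mcounit mcounit_linear.

Lemma mcomul1 : mcomul 1 = 1.
Proof.
by rewrite /mcomul -mpolyX0 mlinX big1 // => i _; rewrite mnm0E expr0.
Qed.

Lemma mcomulX i : mcomul 'X_i = 'X_i *t 1 + 1 *t 'X_i.
Proof.
rewrite /mcomul mlinX (bigD1 i) //= mnm1E eqxx expr1 big1 ?mulr1 // => j ne.
by rewrite mnm1E eq_sym (negbTE ne) expr0.
Qed.

Lemma mcomulMX p i : mcomul (p * 'X_i) = mcomul p * ('X_i *t 1 + 1 *t 'X_i).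
Proof.
elim/mpolyind: p => [|c m p _ _ ih]; first by rewrite !(mul0r, linear0).
rewrite mulrDl !linearD /= ih mulrDl; congr (_ + _).
rewrite -scalerAl !linearZ /= -tscalerAl; congr (_ *: _).
rewrite -mpolyXD /mcomul !mlinX [in LHS](bigD1 i) // [in RHS](bigD1 i) //=.
rewrite mnmDE mnm1E eqxx addn1 exprSr -!mulrA; congr (_ * _).
rewrite mulrC; congr (_ * _).
by apply: eq_bigr => j ne; rewrite mnmDE mnm1E eq_sym (negbTE ne) addn0.
Qed.

Lemma mpoly_Xind (P : A -> Prop) :
  P 1 -> (forall c p, P p -> P (c *: p)) ->
  (forall p q, P p -> P q -> P (p + q)) -> (forall p i, P p -> P (p * 'X_i)) ->
  forall p, P p.
Proof.
move=> P1 PZ PD PX; elim/mpolyind => [|c m p _ _ Pp].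
  by rewrite -(scale0r 1); apply: PZ.
apply: PD => //; apply: PZ => {p c Pp}.
move: {2}(mdeg m) (erefl (mdeg m)) => n.
elim: n m => [|n ih] m def_n.
  by move/eqP: def_n; rewrite mdeg_eq0 => /eqP->; rewrite mpolyX0.
have [i mi] : exists i, (U_(i) <= m)%MM.
  apply/existsP; apply: contra_eqT def_n => /existsPn h.
  suff -> : m = 0%MM by rewrite mdeg0.
  by apply/mnmP => i; move: (h i); rewrite lep1mP negbK mnm0E => /eqP.
rewrite -(submK mi) mpolyXD; apply: PX; apply: ih.
by apply: succn_inj; rewrite -def_n -{2}(submK mi) mdegD mdeg1 addn1.
Qed.

Lemma mcomulM p q : mcomul (p * q) = mcomul p * mcomul q.
Proof.
elim/mpoly_Xind: q => [|c q ih|q q' ih ih'|q i ih].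
- by rewrite mcomul1 !mulr1.
- by rewrite -scalerAr !linearZ /= ih tscalerAr.
- by rewrite mulrDr !linearD /= ih ih' mulrDr.
- by rewrite mulrA !mcomulMX ih mulrA.
Qed.

Lemma mcounit1 : mcounit 1 = 1. Proof. exact: meval1. Qed.
Lemma mcounitM p q : mcounit (p * q) = mcounit p * mcounit q.
Proof. exact: mevalM. Qed.
Lemma mcounitX i : mcounit 'X_i = 0. Proof. exact: mevalXU. Qed.
Lemma mcounitMX p i : mcounit (p * 'X_i) = 0.
Proof. by rewrite mcounitM mcounitX mulr0. Qed.

Definition mpoly_coalgebra : coalgebra A :=
  @gen_coalgebra k A 'I_d (fun i => 'X_i) mpoly_Xind mcomul mcounit
    mcomul1 mcounit1 mcomulMX mcounitMX.

Lemma mpoly_comulE : comul mpoly_coalgebra =1 mcomul. Proof. by []. Qed.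
Lemma mpoly_counitE : counit mpoly_coalgebra =1 mcounit. Proof. by []. Qed.
End PolynomialCoalgebra.

Section PowerSeries.
Variables (k : comNzRingType) (d : nat).

(* k[[x_1, ..., x_d]]: a series is its family of coefficients. *)
Definition powser := 'X_{1..d} -> k.
HB.instance Definition _ := gen_eqMixin powser.
HB.instance Definition _ := gen_choiceMixin powser.

Implicit Types f g h : powser.

Definition ps_zero : powser := fun=> 0.
Definition ps_opp f : powser := fun m => - f m.
Definition ps_add f g : powser := fun m => f m + g m.
Definition ps_scale c f : powser := fun m => c * f m.
Definition ps_one : powser := fun m => (m == 0%MM)%:R.
Definition ps_mul f g : powser := fun m =>
  \sum_(j : 'X_{1..d < (mdeg m).+1, (mdeg m).+1} | m == (j.1 + j.2)%MM)
    f j.1 * g j.2.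

Lemma ps_addA : associative ps_add.
Proof. by move=> f g h; apply/funext => m; exact: addrA. Qed.
Lemma ps_addC : commutative ps_add.
Proof. by move=> f g; apply/funext => m; exact: addrC. Qed.
Lemma ps_add0 : left_id ps_zero ps_add.
Proof. by move=> f; apply/funext => m; exact: add0r. Qed.
Lemma ps_addN : left_inverse ps_zero ps_opp ps_add.
Proof. by move=> f; apply/funext => m; exact: addNr. Qed.
HB.instance Definition _ :=
  GRing.isZmodule.Build powser ps_addA ps_addC ps_add0 ps_addN.

Lemma ps_scaleA c c' f : ps_scale c (ps_scale c' f) = ps_scale (c * c') f.
Proof. by apply/funext => m; exact: mulrA. Qed.
Lemma ps_scale1 : left_id 1 ps_scale.
Proof. by move=> f; apply/funext => m; exact: mul1r. Qed.
Lemma ps_scaleDr : right_distributive ps_scale +%R.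
Proof. by move=> c f g; apply/funext => m; exact: mulrDr. Qed.
Lemma ps_scaleDl f : {morph ps_scale^~ f : a b / a + b}.
Proof. by move=> a b; apply/funext => m; exact: mulrDl. Qed.
HB.instance Definition _ :=
  GRing.Zmodule_isLmodule.Build k powser ps_scaleA ps_scale1 ps_scaleDr ps_scaleDl.

(* The ring axioms are transferred from polynomials by truncation. *)
Definition ps_trunc n f : {mpoly k[d]} := \sum_(j : 'X_{1..d < n}) f j *: 'X_[j].

Lemma ps_truncE n f m : (mdeg m < n)%N -> (ps_trunc n f)@_m = f m.
Proof.
move=> lt_mn; rewrite /ps_trunc linear_sum (bigD1 (BMultinom lt_mn)) //=.
rewrite mcoeffZ mcoeffX eqxx mulr1 big1 ?addr0 // => j ne.
rewrite mcoeffZ mcoeffX; case: eqP => [e|_]; last by rewrite mulr0.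
by move: ne; rewrite eqE /= e eqxx.
Qed.

Lemma ps_mulE p q f g m :
  (forall j, (mdeg j <= mdeg m)%N -> p@_j = f j) ->
  (forall j, (mdeg j <= mdeg m)%N -> q@_j = g j) ->
  ps_mul f g m = (p * q)@_m.
Proof.
move=> hf hg; rewrite mcoeffM; apply: eq_bigr => j _.
by rewrite hf ?hg // -ltnS; exact: bmdeg.
Qed.

Lemma ps_mul_trunc n f g m : (mdeg m < n)%N ->
  ps_mul f g m = (ps_trunc n f * ps_trunc n g)@_m.
Proof.
by move=> lt_mn; apply: ps_mulE => j le_jm; rewrite ps_truncE //;
  exact: leq_ltn_trans lt_mn.
Qed.

Lemma ps_mulA : associative ps_mul.
Proof.
move=> f g h; apply/funext => m; pose n := (mdeg m).+1.
rewrite (@ps_mulE (ps_trunc n f) (ps_trunc n g * ps_trunc n h)).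
- rewrite mulrA; apply/esym; apply: ps_mulE => j le_jm.
    by rewrite (@ps_mul_trunc n).
  by rewrite ps_truncE.
- by move=> j le_jm; rewrite ps_truncE.
- by move=> j le_jm; rewrite (@ps_mul_trunc n).
Qed.
Lemma ps_mulC : commutative ps_mul.
Proof.
by move=> f g; apply/funext => m; rewrite !(@ps_mul_trunc (mdeg m).+1) // mulrC.
Qed.
Lemma ps_mul1 : left_id ps_one ps_mul.
Proof.
move=> f; apply/funext => m.
rewrite (@ps_mulE 1 (ps_trunc (mdeg m).+1 f)) ?mul1r ?ps_truncE //.
- by move=> j _; rewrite mcoeff1.
- by move=> j le_jm; rewrite ps_truncE.
Qed.
Lemma ps_mulDl : left_distributive ps_mul +%R.
Proof.
move=> f g h; apply/funext => m; rewrite -[RHS]/(ps_mul f h m + ps_mul g h m).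
rewrite /ps_mul -big_split; by apply: eq_bigr => j _; exact: mulrDl.
Qed.
Lemma ps_one_neq0 : ps_one != 0.
Proof.
apply/eqP => /(congr1 (fun f : powser => f 0%MM)) /eqP.
by rewrite /ps_one eqxx (negbTE (oner_neq0 _)).
Qed.
HB.instance Definition _ :=
  GRing.Zmodule_isComNzRing.Build powser ps_mulA ps_mulC ps_mul1 ps_mulDl
    ps_one_neq0.

Lemma ps_scaleAl (c : k) f g : c *: (f * g) = c *: f * g.
Proof.
apply/funext => m; rewrite [LHS]mulr_sumr.
by apply: eq_bigr => j _; exact: mulrA.
Qed.
HB.instance Definition _ :=
  GRing.Lmodule_isLalgebra.Build k powser ps_scaleAl.
HB.instance Definition _ := GRing.Lalgebra_isComAlgebra.Build k powser.

(* The duality pairing <f, a>, determined by <f, x^m> = m! f_m.  It identifies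
   k[[x]] with the algebra dual to the coalgebra k[x] when char k = 0, since
   the elements x^m / m! comultiply like divided powers. *)
Definition ps_pair (f : powser) : {mpoly k[d]} -> k^o :=
  mlin (fun m => (\prod_(i < d) (m i)`!)%:R * f m : k^o).
HB.instance Definition _ f := GRing.Linear.on (ps_pair f).
End PowerSeries.

(* Main.v *)
Require Import Defs.
From HB Require Import structures.
From mathcomp Require Import all_boot all_order all_algebra.
From mathcomp Require Import boolp.
From mathcomp Require Import mpoly ring.

Set Implicit Arguments.
Unset Strict Implicit.
Unset Printing Implicit Defensive.

Import GRing.Theory.
Local Open Scope ring_scope.

(** The pairing [<f, x^m> = m! f_m] identifies [k[[x]]] with the linear dual of
    [k[x]] in characteristic 0, and the product of power series is the transpose
    of [Delta] ([ps_pairM]): multiplication by [x_i] on polynomials is transposed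
    to the partial derivative, and the Leibniz rule for it is dual to
    [Delta x_i = x_i ⊗ 1 + 1 ⊗ x_i].

    A linear map [q : A -> A ⊗ A] therefore has a transpose [{-,-}], given by
    [<{f, g}, p> = (f ⊗ g)(q p)].  Evaluating [f ⊗ g] and [f ⊗ g ⊗ h] on the
    three co-Poisson identities gives antisymmetry, the Jacobi identity and the
    Leibniz rule of [{-,-}].  Since these functionals separate the elements of
    [A ⊗ A] and [A ⊗ A ⊗ A] ([tfun_pair_eq0], [tfun3_pair_eq0]), each identity
    for [q] is equivalent to the corresponding one for the bracket
    ([transpose_anti], [transpose_jacobi], [transpose_leibniz]), and [q] is
    determined by its bracket.

    It remains to see that every Poisson bracket on [k[[x]]] is such a transpose,
    which is a continuity statement, as the dual of [k[[x]]] is larger than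
    [k[x]].  By the Leibniz rule, a bracket lowers the order of vanishing of its
    arguments by at most one ([bracket_vanish]): a series of order [n + 1] is a
    finite combination of the variables with coefficients of order [n].  Hence
    the coefficient of [x^m] in [{f, g}] depends only on the terms of [f] and
    [g] of degree at most [|m| + 1], and the tensor [q (x^m)] dual to this
    coefficient is a finite sum ([cotranspose]). *)

(** * Functionals on tensor products *)

Section TensorSums.
Variables (k : comNzRingType) (V W : lmodType k) (I : Type).
Variables (r : seq I) (P : pred I).

Lemma tens_suml (F : I -> V) (w : W) :
  (\sum_(i <- r | P i) F i) *t w = \sum_(i <- r | P i) F i *t w.
Proof.
exact: (big_morph (fun v => v *t w) (fun a b => tensDl a b w) (tens0l V w)).
Qed.

Lemma tens_sumr (v : V) (F : I -> W) :
  v *t (\sum_(i <- r | P i) F i) = \sum_(i <- r | P i) v *t F i.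
Proof.
exact: (big_morph (fun w => v *t w) (tensDr v) (tens0r W v)).
Qed.
End TensorSums.

Section Contraction.
Variables (k : comNzRingType) (V W : lmodType k) (chi : {linear W -> k^o}).

Lemma tcontr_bilin : bilinear_for *:%R *:%R (fun (v : V) (w : W) => chi w *: v).
Proof.
split=> [w a v v'|v a w w'] /=.
  by rewrite scalerDr !scalerA mulrC.
by rewrite linearP scalerDl scalerA.
Qed.

(** The contraction [id ⊗ chi] followed by the identification
    [V ⊗ k = V]. *)
Definition tcontr : V ⊗ W -> V := tlift tcontr_bilin.
HB.instance Definition _ := GRing.Linear.on tcontr.

Lemma tcontrE v w : tcontr (v *t w) = chi w *: v.
Proof. exact: tliftE. Qed.

Lemma tfun_contr (phi : {linear V -> k^o}) t : tfun phi chi t = phi (tcontr t).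
Proof.
elim/tensor_ind: t => [|v w t ih]; first by rewrite !linear0.
by rewrite !linearD /= ih tfunE tcontrE linearZ /= [chi w *: _]mulrC.
Qed.
End Contraction.

Section TensorFunctionals.
Variables (k : comNzRingType) (V W U : lmodType k).
Implicit Types (f : {linear V -> k^o}) (g : {linear W -> k^o}).

Lemma tfun_swap f g (t : W ⊗ V) : tfun f g (tswap t) = tfun g f t.
Proof.
elim/tensor_ind: t => [|v w t ih]; first by rewrite !linear0.
by rewrite !linearD /= ih tswapE !tfunE mulrC.
Qed.

Lemma tfun_tassocV f g (h : {linear U -> k^o}) (t : V ⊗ (W ⊗ U)) :
  tfun (tfun f g) h (tassocV t) = tfun f (tfun g h) t.
Proof.
elim/tensor_ind: t => [|v s t ih]; first by rewrite !linear0.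
rewrite !linearD /= ih; congr (_ + _) => {ih t}.
elim/tensor_ind: s => [|w u s ih]; first by rewrite tens0r !linear0.
by rewrite tensDr !linearD /= ih tassocVE !tfunE /= !tfunE mulrA.
Qed.
End TensorFunctionals.

Lemma tfun_t3 (k : comNzRingType) (V : lmodType k)
    (f g h : {linear V -> k^o}) (t : V ⊗ V ⊗ V) :
  tfun (tfun f g) h (t3 t) = tfun (tfun g h) f t.
Proof. by rewrite /t3 /= tfun_tassocV tfun_swap. Qed.

(** Transposition: pulling a functional back along [u ⊗ v]. *)
Lemma tfun_tmap (k : comNzRingType) (V V' W W' : lmodType k)
    (u : {linear V -> V'}) (v : {linear W -> W'})
    (f : {linear V' -> k^o}) (f' : {linear V -> k^o})
    (g : {linear W' -> k^o}) (g' : {linear W -> k^o}) t :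
  (forall a, f (u a) = f' a) -> (forall b, g (v b) = g' b) ->
  tfun f g (tmap u v t) = tfun f' g' t.
Proof.
move=> hf hg; elim/tensor_ind: t => [|a b t ih]; first by rewrite !linear0.
by rewrite !linearD /= ih tmapE !tfunE hf hg.
Qed.

Section PolynomialTensors.
Variables (k : comNzRingType) (d : nat) (V : lmodType k).
Local Notation A := {mpoly k[d]}.

(** The coefficient functional of a monomial, as a map to the regular module. *)
Definition mcoef (m : 'X_{1..d}) (p : A) : k^o := p@_m.
Lemma mcoef_linear m : linear (mcoef m).
Proof. by move=> a p q; rewrite /mcoef mcoeffD mcoeffZ. Qed.
HB.instance Definition _ m :=
  GRing.isLinear.Build k A k^o *:%R (mcoef m) (mcoef_linear m).

(** A tensor in [V ⊗ k[x]] is the sum of its coefficients in [V] times the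
    monomials, provided that the summation goes beyond the degrees of its
    components. *)
Lemma tensor_mpoly_expand (t : V ⊗ A) : exists n0, forall n, (n0 <= n)%N ->
  t = \sum_(m : 'X_{1..d < n}) tcontr (mcoef m) t *t 'X_[m].
Proof.
elim/tensor_ind: t => [|v p t [n0 ih]].
  by exists 0%N => n _; rewrite big1 // => m _; rewrite linear0 tens0l.
exists (maxn n0 (msize p)) => n; rewrite geq_max => /andP[le0 lep].
rewrite {1}(ih n le0) [in LHS](mpolywE lep).
rewrite [RHS](eq_bigr (fun m : 'X_{1..d < n} =>
  v *t (p@_m *: 'X_[m]) + tcontr (mcoef m) t *t 'X_[m])).
  by rewrite big_split /= tens_sumr.
by move=> m _; rewrite linearD /= tcontrE tensDl tensZr tensZl.
Qed.

Lemma tensor_mpoly_eq0 (t : V ⊗ A) :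
  (forall m, tcontr (mcoef m) t = 0) -> t = 0.
Proof.
move=> h; have [n /(_ n (leqnn n)) ->] := tensor_mpoly_expand t.
by rewrite big1 // => m _; rewrite h tens0l.
Qed.
End PolynomialTensors.

(** * Power series and the duality pairing *)

Section PowerSeriesCalculus.
Variables (k : comNzRingType) (d : nat).
Local Notation A := {mpoly k[d]}.
Local Notation B := (powser k d).
Implicit Types (f g : B) (m : 'X_{1..d}).

(** The coefficient of [x^m], as a functional on power series. *)
Definition ps_coef m f : k^o := f m.
Lemma ps_coef_linear m : linear (ps_coef m).
Proof. by []. Qed.
HB.instance Definition _ m :=
  GRing.isLinear.Build k B k^o *:%R (ps_coef m) (ps_coef_linear m).

Lemma ps_addE f g m : (f + g) m = f m + g m. Proof. by []. Qed.
Lemma ps_oppE f m : (- f) m = - f m. Proof. by []. Qed.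
Lemma ps_scaleE c f m : (c *: f) m = c * f m. Proof. by []. Qed.
Lemma ps_sumE (I : Type) (r : seq I) (P : pred I) (F : I -> B) m :
  (\sum_(i <- r | P i) F i) m = \sum_(i <- r | P i) F i m.
Proof. exact: (raddf_sum (ps_coef m)). Qed.

(** The formal partial derivative with respect to the variable [i]. *)
Definition ps_deriv (i : 'I_d) f : B := fun m => f (m + U_(i))%MM *+ (m i).+1.

Lemma ps_derivM i f g : ps_deriv i (f * g) = ps_deriv i f * g + f * ps_deriv i g.
Proof.
apply/funext => m; pose n := (mdeg m).+2.
(* Both sides at [m] only involve coefficients of degree at most [|m| + 1], so
   the Leibniz rule is that of the truncated polynomials. *)
have tr h j : (mdeg j <= mdeg m)%N ->
    (ps_trunc n h)@_j = h j /\ (mderiv i (ps_trunc n h))@_j = ps_deriv i h j.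
  move=> le_jm; split; first by rewrite ps_truncE // ltnS (leq_trans le_jm).
  by rewrite mcoeff_deriv ps_truncE // mdegD mdeg1 addn1 !ltnS.
rewrite ps_addE -[(ps_deriv i f * g) m]/(ps_mul _ _ _).
rewrite -[(f * ps_deriv i g) m]/(ps_mul _ _ _).
rewrite (@ps_mulE _ _ (mderiv i (ps_trunc n f)) (ps_trunc n g)); first last.
- by move=> j /(tr g) [].
- by move=> j /(tr f) [].
rewrite (@ps_mulE _ _ (ps_trunc n f) (mderiv i (ps_trunc n g))); first last.
- by move=> j /(tr g) [].
- by move=> j /(tr f) [].
rewrite -mcoeffD -mderivM mcoeff_deriv; congr (_ *+ _).
by apply: ps_mul_trunc; rewrite mdegD mdeg1 addn1 /n.
Qed.

(** The monomial [x^m] as a power series. *)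
Definition ps_mono m : B := fun j => (j == m)%:R.

Lemma ps_var_mulE i f m :
  (ps_mono U_(i) * f) m = if (U_(i) <= m)%MM then f (m - U_(i))%MM else 0.
Proof.
rewrite -[LHS]/(ps_mul _ _ _); case: ifPn => [le_im|nle_im].
  rewrite (@ps_mulE _ _ 'X_i (ps_trunc (mdeg m).+1 f)); first last.
  - by move=> j le_jm; rewrite ps_truncE.
  - by move=> j _; rewrite mcoeffX eq_sym.
  rewrite mulrC -{1}(submK le_im) addmC mcoeffMX ps_truncE //.
  by rewrite -{2}(submK le_im) mdegD mdeg1 addn1 ltnS leqW.
rewrite /ps_mul big1 // => j /eqP def_m; rewrite /ps_mono.
case: eqP => [def_j|_]; last by rewrite mul0r.
by case/negP: nle_im; rewrite def_m def_j lem_addr.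
Qed.

Lemma ps_pair_linear (p : A) : linear (fun f : B => ps_pair f p).
Proof.
move=> a f g; rewrite /ps_pair /mlin scaler_sumr -big_split /=.
apply: eq_bigr => m _; rewrite ps_addE ps_scaleE mulrDr scalerDr.
congr (_ + _); have e (x y z w : k) : x * (y * (z * w)) = z * (x * (y * w)).
  by rewrite (mulrCA y z w) (mulrCA x z).
exact: e.
Qed.

Lemma ps_pairD f g p : ps_pair (f + g) p = ps_pair f p + ps_pair g p.
Proof. by have := ps_pair_linear p 1 f g; rewrite !scale1r. Qed.

Lemma ps_pair0 p : ps_pair (0 : B) p = 0.
Proof.
by have /eqP := ps_pairD 0 0 p; rewrite addr0 -subr_eq subrr eq_sym => /eqP.
Qed.

Lemma ps_pairZ c f p : ps_pair (c *: f) p = c * ps_pair f p.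
Proof.
by have := ps_pair_linear p c f 0; rewrite ps_pair0 !addr0.
Qed.

Lemma ps_pairN f p : ps_pair (- f) p = - ps_pair f p.
Proof. by rewrite -scaleN1r ps_pairZ mulN1r. Qed.

(** The multifactorial [m! = m_1! ... m_d!]. *)
Definition mfact m : nat := \prod_(i < d) (m i)`!.

Lemma ps_pairX f m : ps_pair f 'X_[m] = (mfact m)%:R * f m.
Proof. exact: mlinX. Qed.

(** Multiplication of polynomials by a variable is the transpose of a partial
    derivative. *)
Lemma ps_pairMX f p i : ps_pair f (p * 'X_i) = ps_pair (ps_deriv i f) p.
Proof.
elim/mpolyind: p => [|c m p _ _ ih]; first by rewrite mul0r !linear0.
rewrite mulrDl !linearD /= ih -scalerAl !linearZ /=; congr (_ *: _ + _).
have e (a b : nat) (x : k) : (a * b)%:R * x = a%:R * (x *+ b).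
  by rewrite -[x *+ b]mulr_natl natrM mulrA.
rewrite -mpolyXD !ps_pairX.
have -> : (mfact (m + U_(i)) = mfact m * (m i).+1)%N.
  rewrite /mfact [LHS](bigD1 i) // [in RHS](bigD1 i) //=.
  rewrite mnmDE mnm1E eqxx addn1 factS -mulnA mulnC; congr (_ * _)%N.
  congr (_ * _)%N.
  by apply: eq_bigr => j ne; rewrite mnmDE mnm1E eq_sym (negbTE ne) addn0.
exact: e.
Qed.

Lemma tfun_pair_mulr f g i (t : A ⊗ A) :
  tfun (ps_pair f) (ps_pair g) (t * ('X_i *t 1 + 1 *t 'X_i)) =
  tfun (ps_pair (ps_deriv i f)) (ps_pair g) t +
  tfun (ps_pair f) (ps_pair (ps_deriv i g)) t.
Proof.
elim/tensor_ind: t => [|a b t ih]; first by rewrite mul0r !linear0 addr0.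
rewrite mulrDl !linearD /= ih [RHS]addrACA; congr (_ + _).
by rewrite mulrDr !tensM !mulr1 linearD /= !tfunE /= !ps_pairMX.
Qed.

(** Under the duality pairing, the product of power series is the transpose of
    the comultiplication of polynomials: multiplying a polynomial by a variable
    is transposed to a partial derivative, and the Leibniz rule corresponds to
    multiplying the coproduct by [x_i ⊗ 1 + 1 ⊗ x_i]. *)
Lemma ps_pairM f g (p : A) :
  ps_pair (f * g) p = tfun (ps_pair f) (ps_pair g) (mcomul p).
Proof.
elim/mpoly_Xind: p f g => [|c p ih|p q ihp ihq|p i ih] f g.
- rewrite mcomul1 tens1 tfunE /= -mpolyX0 !ps_pairX.
  have -> : mfact 0%MM = 1%N.
    by rewrite /mfact big1 // => i _; rewrite mnm0E.
  rewrite !mul1r -[LHS]/(ps_mul _ _ _).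
  rewrite (@ps_mulE _ _ (f 0%MM)%:MP (g 0%MM)%:MP); first last.
  + by move=> j; rewrite mdeg0 leqn0 mdeg_eq0 => /eqP->; rewrite mcoeffC eqxx mulr1.
  + by move=> j; rewrite mdeg0 leqn0 mdeg_eq0 => /eqP->; rewrite mcoeffC eqxx mulr1.
  by rewrite -mpolyCM mcoeffC eqxx mulr1.
- by rewrite !linearZ /= ih.
- by rewrite !linearD /= ihp ihq.
- by rewrite ps_pairMX ps_derivM mcomulMX tfun_pair_mulr -!ih ps_pairD.
Qed.
End PowerSeriesCalculus.

(** * Duality between brackets and cobrackets *)

Section Duality.
Variables (k : fieldType) (d : nat).
Hypothesis char0 : [pchar k] =i pred0.
Local Notation A := {mpoly k[d]}.
Local Notation B := (powser k d).
Implicit Types (f g h : B) (m : 'X_{1..d}).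

Lemma mfact_neq0 m : (mfact m)%:R != 0 :> k.
Proof.
rewrite ((pcharf0P k).1 char0) -lt0n prodn_gt0 // => i; exact: fact_gt0.
Qed.

(** The series [x^m / m!], dual to the monomial [x^m]. *)
Definition ps_dual m : B := (mfact m)%:R^-1 *: ps_mono k m.

Lemma ps_pair_dual m p : ps_pair (ps_dual m) p = mcoef m p.
Proof.
apply: (mlin_ext (f := ps_pair (ps_dual m)) (g := @mcoef k d m)) => j /=.
rewrite ps_pairX /ps_dual ps_scaleE /ps_mono /mcoef mcoeffX.
by case: eqP => [->|_]; rewrite ?mulr0 // mulr1 mulfV ?mfact_neq0.
Qed.

Lemma ps_pair_inj f g : (forall p, ps_pair f p = ps_pair g p) -> f = g.
Proof.
move=> e; apply/funext => m; apply: (mulfI (mfact_neq0 m)).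
by have := e 'X_[m]; rewrite !ps_pairX.
Qed.

Lemma ps_pair_eq0 (p : A) : (forall f, ps_pair f p = 0) -> p = 0.
Proof.
move=> h; apply/mpolyP => m; rewrite mcoeff0 -[LHS]/(mcoef m p).
by rewrite -ps_pair_dual.
Qed.

Lemma tcontr_pair_eq0 (V : lmodType k) (t : V ⊗ A) :
  (forall g, tcontr (ps_pair g) t = 0) -> t = 0.
Proof.
move=> h; apply: tensor_mpoly_eq0 => m; rewrite -[RHS](h (ps_dual m)).
apply: (@tlinear_ext _ _ _ _ (tcontr (mcoef m)) (tcontr (ps_pair (ps_dual m)))).
by move=> v p /=; rewrite !tcontrE /= ps_pair_dual.
Qed.

(** Power series separate the elements of the tensor powers of [k[x]]. *)
Lemma tfun_pair_eq0 (t : A ⊗ A) :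
  (forall f g, tfun (ps_pair f) (ps_pair g) t = 0) -> t = 0.
Proof.
move=> e; apply: tcontr_pair_eq0 => g; apply: ps_pair_eq0 => f.
exact: etrans (esym (tfun_contr _ _ _)) (e f g).
Qed.

Lemma tfun3_pair_eq0 (t : A ⊗ A ⊗ A) :
  (forall f g h, tfun (tfun (ps_pair f) (ps_pair g)) (ps_pair h) t = 0) -> t = 0.
Proof.
move=> e; apply: tcontr_pair_eq0 => h; apply: tfun_pair_eq0 => f g.
exact: etrans (esym (tfun_contr _ _ _)) (e f g h).
Qed.

Section Transpose.
Variables (D : {linear A -> A ⊗ A}) (P : {linear B ⊗ B -> B}).
(** [P] is the transpose of [D]. *)
Hypothesis PD : forall f g p,
  ps_pair (P (f *t g)) p = tfun (ps_pair f) (ps_pair g) (D p).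

Lemma transpose_anti :
  (forall c, D c + t2 (D c) = 0) <->
  (forall f g, P (f *t g) + P (g *t f) = 0).
Proof.
have e f g c : ps_pair (P (f *t g) + P (g *t f)) c =
    tfun (ps_pair f) (ps_pair g) (D c + t2 (D c)).
  by rewrite ps_pairD !PD linearD /= /t2 tfun_swap.
split=> [h f g|h c].
  by apply: ps_pair_inj => c; rewrite e h linear0 ps_pair0.
by apply: tfun_pair_eq0 => f g; rewrite -e h ps_pair0.
Qed.

(** The brackets are nested on the left, since [(D ⊗ 1) D] is transposed to
    [{{f, g}, h}]. *)
Lemma transpose_jacobi :
  (forall c, let w := tmap D idfun (D c) in w + t3 w + t3 (t3 w) = 0) <->
  (forall f g h, P (P (f *t g) *t h) + P (P (g *t h) *t f) +
    P (P (h *t f) *t g) = 0).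
Proof.
have e0 f g h c : ps_pair (P (P (f *t g) *t h)) c =
    tfun (tfun (ps_pair f) (ps_pair g)) (ps_pair h) (tmap D idfun (D c)).
  by rewrite PD; apply/esym/tfun_tmap => // p; rewrite /= PD.
pose w c := tmap D idfun (D c).
have e f g h c : ps_pair (P (P (f *t g) *t h) + P (P (g *t h) *t f) +
      P (P (h *t f) *t g)) c =
    tfun (tfun (ps_pair f) (ps_pair g)) (ps_pair h)
      (w c + t3 (w c) + t3 (t3 (w c))).
  by rewrite !ps_pairD !e0 !linearD /= !tfun_t3.
split=> [h0 f g h|h0 c].
  by apply: ps_pair_inj => c; rewrite e [X in tfun _ _ X](h0 c) linear0 ps_pair0.
by apply: tfun3_pair_eq0 => f g h; rewrite -e h0 ps_pair0.
Qed.

(** The last term of the co-Leibniz identity is transposed to [{h, f} g], which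
    accounts for its sign. *)
Lemma transpose_leibniz :
  (forall c, tmap (@mcomul k d) idfun (D c) =
     tassocV (tmap idfun D (mcomul c)) - t3 (t3 (tmap D idfun (mcomul c)))) <->
  (forall f g h, P ((f * g) *t h) = f * P (g *t h) - P (h *t f) * g).
Proof.
have el f g h c : ps_pair (P ((f * g) *t h)) c =
    tfun (tfun (ps_pair f) (ps_pair g)) (ps_pair h) (tmap (@mcomul k d) idfun (D c)).
  by rewrite PD; apply/esym/tfun_tmap => // p; rewrite /= ps_pairM.
have er f g h c : ps_pair (f * P (g *t h) - P (h *t f) * g) c =
    tfun (tfun (ps_pair f) (ps_pair g)) (ps_pair h) (tassocV (tmap idfun D (mcomul c))
      - t3 (t3 (tmap D idfun (mcomul c)))).
  rewrite ps_pairD ps_pairN linearB /=; congr (_ - _).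
    rewrite ps_pairM tfun_tassocV; apply/esym/tfun_tmap => // p.
    by rewrite /= PD.
  rewrite ps_pairM !tfun_t3; apply/esym/tfun_tmap => // p.
  by rewrite /= PD.
split=> [e f g h|e c].
  by apply: ps_pair_inj => c; rewrite el er e.
apply/eqP; rewrite -subr_eq0; apply/eqP; apply: tfun3_pair_eq0 => f g h.
by rewrite linearB /= -el -er e subrr.
Qed.
End Transpose.

Section TransposeOperation.
Variable D : {linear A -> A ⊗ A}.

(** The series [{f, g}] determined by [<{f, g}, p> = (f ⊗ g)(D p)]. *)
Definition transpose_op f g : B :=
  fun m => tfun (ps_pair f) (ps_pair g) (D 'X_[m]) / (mfact m)%:R.

Lemma transpose_opE f g p :
  ps_pair (transpose_op f g) p = tfun (ps_pair f) (ps_pair g) (D p).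
Proof.
apply: (mlin_ext (f := ps_pair (transpose_op f g))
  (g := tfun (ps_pair f) (ps_pair g) \o D)) => m /=.
by rewrite ps_pairX /transpose_op mulrC divfK ?mfact_neq0.
Qed.

Lemma transpose_op_bilin : bilinear_for *:%R *:%R transpose_op.
Proof.
split=> [g a f f'|f a g g']; apply: ps_pair_inj => p /=;
  rewrite ps_pairD ps_pairZ !transpose_opE.
- elim/tensor_ind: (D p) => [|u v t ih]; first by rewrite !linear0 mulr0 addr0.
  rewrite !linearD /= ih mulrDr addrACA; congr (_ + _).
  by rewrite !tfunE /= ps_pairD ps_pairZ mulrDl mulrA.
- elim/tensor_ind: (D p) => [|u v t ih]; first by rewrite !linear0 mulr0 addr0.
  rewrite !linearD /= ih mulrDr addrACA; congr (_ + _).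
  by rewrite !tfunE /= ps_pairD ps_pairZ mulrDr mulrCA.
Qed.

(** The transpose of a linear map [k[x] -> k[x] ⊗ k[x]]. *)
Definition transpose : {linear B ⊗ B -> B} := tlift transpose_op_bilin.

Lemma transposeE f g p :
  ps_pair (transpose (f *t g)) p = tfun (ps_pair f) (ps_pair g) (D p).
Proof. by rewrite /transpose /= tliftE transpose_opE. Qed.
End TransposeOperation.

Lemma two_neq0 : 2%:R != 0 :> k.
Proof. by rewrite ((pcharf0P k).1 char0). Qed.

(** In characteristic 0, alternating and antisymmetric brackets coincide. *)
Lemma bilin_anti (P : {linear B ⊗ B -> B}) :
  (forall f, P (f *t f) = 0) <-> (forall f g, P (f *t g) + P (g *t f) = 0).
Proof.
split=> [h f g|h f].
  by have := h (f + g); rewrite tensDl !tensDr !linearD /= !h add0r addr0.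
have /eqP := h f f; rewrite -mulr2n -scaler_nat scaler_eq0 (negbTE two_neq0).
by move/eqP.
Qed.

Section DualPoisson.
Variable q : copoisson_structure (mpoly_coalgebra k d).
Local Notation P := (transpose q).

Let P_anti f g : P (f *t g) = - P (g *t f).
Proof.
apply/eqP; rewrite -addr_eq0; apply/eqP.
exact: ((transpose_anti (transposeE q)).1 (@cobracket_anti _ _ _ q)).
Qed.

Lemma dual_alt f : P (f *t f) = 0.
Proof.
apply: (bilin_anti P).2 => {}f g; apply/eqP.
by rewrite addr_eq0 P_anti.
Qed.

Lemma dual_jacobi f g h : P (f *t P (g *t h)) + P (g *t P (h *t f)) +
  P (h *t P (f *t g)) = 0.
Proof.
rewrite (P_anti f) (P_anti g (P _)) (P_anti h (P _)) -!opprD addrC addrA.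
apply/eqP; rewrite oppr_eq0; apply/eqP.
exact: ((transpose_jacobi (transposeE q)).1 (@cobracket_jacobi _ _ _ q)).
Qed.

Lemma dual_leibniz f g h :
  P ((f * g) *t h) = f * P (g *t h) + P (f *t h) * g.
Proof.
rewrite ((transpose_leibniz (transposeE q)).1 (@cobracket_leibniz _ _ _ q)).
by rewrite (P_anti f h) mulNr.
Qed.

(** The Poisson bracket on power series dual to a co-Poisson structure. *)
Definition dual_poisson : poisson_structure B :=
  Poisson dual_alt dual_jacobi dual_leibniz.

Lemma dual_poissonE f g p :
  ps_pair (dual_poisson (f *t g)) p = tfun (ps_pair f) (ps_pair g) (q p).
Proof. exact: transposeE. Qed.
End DualPoisson.

(** * Continuity of Poisson brackets on power series *)

Section Continuity.
Variable P : {linear B ⊗ B -> B}.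
Hypothesis P_anti : forall f g, P (f *t g) + P (g *t f) = 0.
Hypothesis P_leibniz : forall f g h,
  P ((f * g) *t h) = f * P (g *t h) + P (f *t h) * g.

Let P_sumE (I : finType) (F : I -> B ⊗ B) m :
  P (\sum_i F i) m = \sum_i P (F i) m.
Proof. exact: (linear_sum (ps_coef m \o P)). Qed.

Let P_scaleE c t m : P (c *: t) m = c * P t m.
Proof. by rewrite linearZ. Qed.

(** [f] has no term of degree less than [n], that is, it lies in the [n]-th power
    of the maximal ideal. *)
Definition ps_vanish n f := forall m, (mdeg m < n)%N -> f m = 0.

Lemma ps_vanishM a b f g :
  ps_vanish a f -> ps_vanish b g -> ps_vanish (a + b) (f * g).
Proof.
move=> vf vg m lt_m; rewrite -[LHS]/(ps_mul _ _ _).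
rewrite /ps_mul big1 // => j /eqP def_m.
have [lt_a|le_a] := ltnP (mdeg j.1) a; first by rewrite vf ?mul0r.
rewrite vg ?mulr0 // ltnNge; apply/negP => le_b.
by move: lt_m; rewrite def_m mdegD ltnNge leq_add.
Qed.

(** A series vanishing at the origin to order [n + 1] is a combination of the
    variables with coefficients vanishing to order [n], by Euler's formula
    [\sum_i x_i ∂_i f = (deg f) f] for homogeneous [f]. *)
Lemma ps_euler n f : ps_vanish n.+1 f ->
  exists2 F : 'I_d -> B, (forall i, ps_vanish n (F i)) &
    f = \sum_(i < d) ps_mono k U_(i) * F i.
Proof.
(* Each term of degree [e] of the derivative is divided by [e + 1], the degree
   of the term of [f] that it comes from. *)
move=> vf; exists (fun i m => ps_deriv i f m / (mdeg m).+1%:R) => [i m lt_m|].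
  by rewrite /ps_deriv vf ?mul0rn ?mul0r // mdegD mdeg1 addn1 ltnS.
apply/funext => m; rewrite ps_sumE.
have [m0|m_gt0] := posnP (mdeg m).
  rewrite vf ?m0 // big1 // => i _; rewrite ps_var_mulE.
  move/eqP: m0; rewrite mdeg_eq0 => /eqP->.
  by rewrite lep1mP mnm0E eqxx.
have Nm : (mdeg m)%:R != 0 :> k by rewrite ((pcharf0P k).1 char0) -lt0n.
apply: (mulIf Nm); rewrite mulr_suml mulr_natr {1}mdegE -sumrMnr.
apply: eq_bigr => i _; rewrite ps_var_mulE lep1mP.
case: (posnP (m i)) => [->|m_i]; first by rewrite mul0r.
have le_im : (U_(i) <= m)%MM by rewrite lep1mP -lt0n.
rewrite /=; set j := (m - U_(i))%MM.
have def_m : m = (j + U_(i))%MM by rewrite /j submK.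
rewrite /ps_deriv -def_m.
have -> : (mdeg j).+1 = mdeg m by rewrite def_m mdegD mdeg1 addn1.
have -> : (j i).+1 = m i by rewrite def_m mnmDE mnm1E eqxx addn1.
by rewrite divfK.
Qed.

(** A bracket lowers the order of vanishing by at most one. *)
Lemma bracket_vanish n f g : ps_vanish n.+1 f -> ps_vanish n (P (f *t g)).
Proof.
elim: n f => [|n ih] f vf; first by [].
have [F vF ->] := ps_euler vf => m lt_m.
rewrite tens_suml P_sumE big1 // => i _; rewrite P_leibniz ps_addE.
rewrite (_ : _ m = 0) ?add0r.
  by rewrite -[n.+1]add0n in lt_m; apply: (ps_vanishM _ (vF i) lt_m).
suff /(_ m): ps_vanish (1 + n) (ps_mono k U_(i) * P (F i *t g)) by apply.
apply: ps_vanishM => [j|]; last exact/ih/vF.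
rewrite ltnS leqn0 mdeg_eq0 => /eqP->; rewrite /ps_mono.
by case: eqP => // /(congr1 mdeg); rewrite mdeg0 mdeg1.
Qed.

(** The truncation of a series in degrees less than [n], as a series. *)
Definition ps_trunc_ser n f : B := \sum_(i : 'X_{1..d < n}) f i *: ps_mono k i.

Lemma ps_trunc_vanish n f : ps_vanish n (f - ps_trunc_ser n f).
Proof.
move=> m lt_m; rewrite ps_addE ps_oppE /ps_trunc_ser ps_sumE.
rewrite (bigD1 (BMultinom lt_m)) //= big1 => [|i ne].
  by rewrite addr0 ps_scaleE /ps_mono eqxx mulr1 subrr.
rewrite ps_scaleE /ps_mono; case: eqP => [e|_]; last by rewrite mulr0.
by move: ne; rewrite eqE /= e eqxx.
Qed.

(** The coefficients of a bracket only depend on truncations of its arguments. *)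
Lemma bracket_trunc f g m : let n := (mdeg m).+2 in
  P (f *t g) m = P (ps_trunc_ser n f *t ps_trunc_ser n g) m.
Proof.
move=> n.
have vl f' g' : P (f' *t g') m = P (ps_trunc_ser n f' *t g') m.
  rewrite -{1}[f'](subrK (ps_trunc_ser n f')) tensDl linearD ps_addE.
  by rewrite (bracket_vanish _ (@ps_trunc_vanish _ _)) ?add0r.
have vr f' g' : P (f' *t g') = - P (g' *t f').
  by apply/eqP; rewrite -addr_eq0; apply/eqP; exact: P_anti.
by rewrite vl vr ps_oppE vl -ps_oppE -vr.
Qed.

(** The transpose of a Poisson bracket.  Since the bracket lowers the order of
    vanishing by at most one, the coefficient of [x^m] in [{f, g}] involves only
    the coefficients of [f] and [g] in degrees at most [|m| + 1], so that the
    sum below is finite. *)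
Definition cotranspose : {linear A -> A ⊗ A} :=
  mlin (fun m => (mfact m)%:R *: \sum_(i : 'X_{1..d < (mdeg m).+2})
    \sum_(j : 'X_{1..d < (mdeg m).+2})
      P (ps_dual i *t ps_dual j) m *: ('X_[i] *t 'X_[j])).

Lemma cotransposeE f g p :
  ps_pair (P (f *t g)) p = tfun (ps_pair f) (ps_pair g) (cotranspose p).
Proof.
apply: (mlin_ext (f := ps_pair (P (f *t g)))
  (g := tfun (ps_pair f) (ps_pair g) \o cotranspose)) => m /=.
rewrite ps_pairX /cotranspose /= mlinX linearZ /=; congr (_ * _).
rewrite bracket_trunc linear_sum /=.
have sl (f' : B) n : ps_trunc_ser n f *t f' =
    \sum_(i : 'X_{1..d < n}) f i *: (ps_mono k i *t f') :> B ⊗ B.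
  by rewrite tens_suml; apply: eq_bigr => i _; rewrite tensZl.
have sr (f' : B) n : f' *t ps_trunc_ser n g =
    \sum_(j : 'X_{1..d < n}) g j *: (f' *t ps_mono k j) :> B ⊗ B.
  by rewrite tens_sumr; apply: eq_bigr => i _; rewrite tensZr.
rewrite sl P_sumE; apply: eq_bigr => i _.
rewrite P_scaleE sr P_sumE mulr_sumr linear_sum /=.
apply: eq_bigr => j _.
rewrite P_scaleE linearZ /= tfunE /= !ps_pairX /ps_dual tensZl tensZr !P_scaleE.
have e (a b x y z : k) : a != 0 -> b != 0 ->
    x * (y * z) = a^-1 * (b^-1 * z) * (a * x * (b * y)).
  by move=> a0 b0; field; rewrite b0.
by apply: e; exact: mfact_neq0.
Qed.
End Continuity.

Section CodualPoisson.
Variable P : poisson_structure B.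

Let P_anti : forall f g, P (f *t g) + P (g *t f) = 0.
Proof. exact: (bilin_anti P).1 (bracket_alt P). Qed.

Let PD f g p :
  ps_pair (P (f *t g)) p = tfun (ps_pair f) (ps_pair g) (cotranspose P p).
Proof. by apply: cotransposeE => // a b c; exact: bracket_leibniz. Qed.

Let P_opp f g : P (f *t g) = - P (g *t f).
Proof. by apply/eqP; rewrite -addr_eq0; apply/eqP; exact: P_anti. Qed.

Lemma codual_anti c : cotranspose P c + t2 (cotranspose P c) = 0.
Proof. exact: (transpose_anti PD).2. Qed.

Lemma codual_jacobi c : let w := tmap (cotranspose P) idfun (cotranspose P c) in
  w + t3 w + t3 (t3 w) = 0.
Proof.
apply: (transpose_jacobi PD).2 => f g h.
rewrite (P_opp (P (f *t g))) (P_opp (P (g *t h))) (P_opp (P (h *t f))) -!opprD.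
by apply/eqP; rewrite oppr_eq0; apply/eqP; exact: bracket_jacobi.
Qed.

Lemma codual_leibniz c : tmap (comul (mpoly_coalgebra k d)) idfun (cotranspose P c) =
  tassocV (tmap idfun (cotranspose P) (comul (mpoly_coalgebra k d) c))
  - t3 (t3 (tmap (cotranspose P) idfun (comul (mpoly_coalgebra k d) c))).
Proof.
apply: (transpose_leibniz PD).2 => f g h.
by rewrite (P_opp h f) mulNr opprK; exact: bracket_leibniz.
Qed.

(** The co-Poisson structure on polynomials dual to a Poisson bracket. *)
Definition codual_copoisson : copoisson_structure (mpoly_coalgebra k d) :=
  CoPoisson codual_anti codual_jacobi codual_leibniz.

Lemma codual_copoissonE f g p :
  ps_pair (P (f *t g)) p = tfun (ps_pair f) (ps_pair g) (codual_copoisson p).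
Proof. exact: PD. Qed.
End CodualPoisson.
End Duality.

(** * The correspondence *)

Lemma linear_funext (k : pzSemiRingType) (V W : lSemiModType k)
    (f g : {linear V -> W}) : f =1 g -> f = g.
Proof.
case: f => f [[f0] [fD]]; case: g => g [[g0] [gD]] /= /funext e.
case: g / e g0 gD => g0 gD.
by rewrite (Prop_irrelevance f0 g0) (Prop_irrelevance fD gD).
Qed.

Lemma copoisson_ext (k : comNzRingType) (C : lmodType k) (H : coalgebra C)
  (q q' : copoisson_structure H) : q =1 q' -> q = q'.
Proof.
case: q => q q1 q2 q3; case: q' => q' q1' q2' q3' /= /linear_funext e.
case: q' / e q1' q2' q3' => q1' q2' q3'.
by rewrite (Prop_irrelevance q1 q1') (Prop_irrelevance q2 q2')
  (Prop_irrelevance q3 q3').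
Qed.

Lemma poisson_ext (k : comNzRingType) (B : algType k)
  (P P' : poisson_structure B) : P =1 P' -> P = P'.
Proof.
case: P => P p1 p2 p3; case: P' => P' p1' p2' p3' /= /linear_funext e.
case: P' / e p1' p2' p3' => p1' p2' p3'.
by rewrite (Prop_irrelevance p1 p1') (Prop_irrelevance p2 p2')
  (Prop_irrelevance p3 p3').
Qed.

Theorem theorem5p8 (k : fieldType) (char0 : [pchar k] =i pred0) (d : nat) :
  exists Phi : copoisson_structure (mpoly_coalgebra k d) ->
               poisson_structure (powser k d),
    bijective Phi /\
    forall (q : copoisson_structure (mpoly_coalgebra k d))
           (f g : powser k d) (p : {mpoly k[d]}),
      ps_pair (Phi q (f *t g)) p = tfun (ps_pair f) (ps_pair g) (q p).
Proof.
exists (dual_poisson char0); split; last exact: dual_poissonE.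
exists (codual_copoisson char0) => [q|P].
  apply: copoisson_ext => p; apply/eqP; rewrite -subr_eq0; apply/eqP.
  apply: (tfun_pair_eq0 char0) => f g; rewrite [LHS]linearB.
  apply/eqP; rewrite subr_eq0; apply/eqP.
  exact: etrans (esym (codual_copoissonE _ _ _ _ _)) (dual_poissonE _ _ _ _ _).
apply: poisson_ext; apply: tlinear_ext => f g.
apply: (ps_pair_inj char0) => p; rewrite dual_poissonE.
exact/esym/codual_copoissonE.
Qed.
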